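(* The polynomial $\Theta_4(X_1,X_2,X_3,X_4)\in\mathbb F_2[X_1,\dots,X_4]$ is irreducible over the algebraic closure $\overline{\mathbb F}_2$, where \[ \Theta_4=m_{(8)}+m_{(4,4)}+m_{(4,2,2)}+m_{(4,2,1,1)}+m_{(2,2,2,2)}. \]
   Context: For a partition $\lambda$ with at most $4$ parts, $m_\lambda(X_1,\dots,X_4)$ is the monomial symmetric polynomial: the sum of all distinct monomials $X_1^{\alpha_1}X_2^{\alpha_2}X_3^{\alpha_3}X_4^{\alpha_4}$ with $(\alpha_1,\dots,\alpha_4)$ a rearrangement of $\lambda$ padded with zeros. Explicitly, $m_{(8)}=\sum_i X_i^8$, $m_{(4,4)}=\sum_{i<j}X_i^4X_j^4$, $m_{(4,2,2)}$ is the sum of the 12 monomials $X_i^4X_j^2X_k^2$ ($i,j,k$ distinct, $j<k$), $m_{(4,2,1,1)}$ is the sum of the 12 monomials $X_i^4X_j^2X_kX_l$ ($\{i,j,k,l\}=\{1,2,3,4\}$, $i\ne j$), and $m_{(2,2,2,2)}=X_1^2X_2^2X_3^2X_4^2$. *)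

(* Defs.v *)
From HB Require Import structures.
From mathcomp Require Import all_boot all_order all_algebra all_field.
From mathcomp Require Import mpoly.

Set Implicit Arguments.
Unset Strict Implicit.
Unset Printing Implicit Defensive.

Import GRing.Theory.

Local Open Scope ring_scope.

Definition irreducible_elt (A : idomainType) (p : A) : Prop :=
  [/\ p != 0, p \isn't a GRing.unit
    & forall q r : A, p = q * r ->
        q \is a GRing.unit \/ r \is a GRing.unit].

(* [permutations] is duplicate-free, so each distinct monomial occurs once;
   the definition is meaningful only for [size la <= n]. *)
Definition monomial_sym (R : nzRingType) (n : nat) (la : seq nat) :
    {mpoly R[n]} :=
  \sum_(a <- permutations (la ++ nseq (n - size la) 0%N))
     'X_[[multinom nth 0%N a i | i < n]].

Definition Theta4 : {mpoly 'F_2[4]} :=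
  monomial_sym _ 4 [:: 8] + monomial_sym _ 4 [:: 4; 4]
  + monomial_sym _ 4 [:: 4; 2; 2] + monomial_sym _ 4 [:: 4; 2; 1; 1]
  + monomial_sym _ 4 [:: 2; 2; 2; 2].

(* An algebraic closure of F: an algebraically closed K with an embedding
   of F over which every element of K is algebraic ([integralRange] asks
   for a monic annihilating polynomial, which over a field is the same).
   For countable F one is given by [countable_algebraic_closure]. *)
Definition is_algebraic_closure (F : fieldType) (K : closedFieldType)
    (iota : {rmorphism F -> K}) : Prop :=
  integralRange iota.

(* Main.v *)
Require Import Defs.
From HB Require Import structures.
From mathcomp Require Import all_boot all_order all_algebra all_field.
From mathcomp Require Import mpoly.
From mathcomp Require Import ring.

Set Implicit Arguments.
Unset Strict Implicit.
Unset Printing Implicit Defensive.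

Import GRing.Theory.

Local Open Scope ring_scope.

(** Let a^3 = a^2 + 1 in K and substitute a t + a^2, a^2 t + a^4, a^4 t + a
  for X_1, X_2, X_3.  These three linear forms have elementary symmetric
  functions t + 1, t and t^3 + t^2 + 1, which turns Theta_4 into
    p(t, y) = y^8 + t y^4 + t^5 y^2 + (t^7 + 1) y + t^2,  y = X_4.
  If Theta_4 is a product of two non-units, these have total degree at most 7,
  and p = q r accordingly.  Fix t with t^7 = 1.  A common zero y of q and r
  would kill p and dp/dt = y^4 + t^4 y^2 + t^6 y, but then
  p - (dp/dt)^2 = t^2 would vanish.  So q(t, -) and r(t, -) are coprime, and
  since dp/dy = t^7 + 1 is zero there, both have zero derivative.  Thus dq/dy
  and dr/dy, of degree at most 6, vanish at seven values of t, hence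
  identically; this contradicts dp/dy <> 0. *)

(** * Symmetric functions and the choice of the linear forms *)

Definition Theta_section (R : comNzRingType) (t y : R) :=
  y ^+ 8 + t * y ^+ 4 + t ^+ 5 * y ^+ 2 + (t ^+ 7 + 1) * y + t ^+ 2.

Lemma sum_Theta4_monomials (R : comNzRingType) (t x1 x2 x3 y : R) :
  2%:R = 0 :> R ->
  x1 + x2 + x3 = t + 1 -> x1 * x2 + x1 * x3 + x2 * x3 = t ->
  x1 * x2 * x3 = t ^+ 3 + t ^+ 2 + 1 ->
  (x1 ^+ 8 + x2 ^+ 8 + x3 ^+ 8 + y ^+ 8) +
  (x1 ^+ 4 * x2 ^+ 4 + x1 ^+ 4 * x3 ^+ 4 + x1 ^+ 4 * y ^+ 4 +
   x2 ^+ 4 * x3 ^+ 4 + x2 ^+ 4 * y ^+ 4 + x3 ^+ 4 * y ^+ 4) +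
  (x1 ^+ 4 * (x2 ^+ 2 * x3 ^+ 2 + x2 ^+ 2 * y ^+ 2 + x3 ^+ 2 * y ^+ 2) +
   x2 ^+ 4 * (x1 ^+ 2 * x3 ^+ 2 + x1 ^+ 2 * y ^+ 2 + x3 ^+ 2 * y ^+ 2) +
   x3 ^+ 4 * (x1 ^+ 2 * x2 ^+ 2 + x1 ^+ 2 * y ^+ 2 + x2 ^+ 2 * y ^+ 2) +
   y ^+ 4 * (x1 ^+ 2 * x2 ^+ 2 + x1 ^+ 2 * x3 ^+ 2 + x2 ^+ 2 * x3 ^+ 2)) +
  x1 * x2 * x3 * y *
  (x1 ^+ 3 * (x2 + x3 + y) + x2 ^+ 3 * (x1 + x3 + y) + x3 ^+ 3 * (x1 + x2 + y) +
   y ^+ 3 * (x1 + x2 + x3)) + (x1 * x2 * x3 * y) ^+ 2 = Theta_section t y.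
Proof.
move=> char2 E1 E2 E3.
(* [m4] is $m_{(4)}+m_{(2,2)}+m_{(2,1,1)}$ in three variables, written in the elementary symmetric
   functions. It gives the coefficient of $y^4$ and, at the squares of the variables, the constant
   term. *)
pose m4 (e1 e2 e3 : R) :=
  e1 ^+ 4 - 4 * e1 ^+ 2 * e2 + 3 * e2 ^+ 2 + 3 * e1 * e3.
(* The left side sorted by powers of [y]; [f1], [f2], [f3] are the elementary symmetric functions of
   the squares $x_i^2$. *)
pose f (e1 e2 e3 : R) :=
 let f1 := e1 ^+ 2 - 2 * e2 in let f2 := e2 ^+ 2 - 2 * e1 * e3 in
 let f3 := e3 ^+ 2 in
 y ^+ 8 + m4 e1 e2 e3 * y ^+ 4 +
 (f1 * f2 - 3 * f3 + e3 * (e1 ^+ 3 - 3 * e1 * e2 + 3 * e3) + f3) * y ^+ 2 +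
 e3 * (e1 ^+ 2 * e2 - 2 * e2 ^+ 2 - e1 * e3) * y + m4 f1 f2 f3.
transitivity (f (x1 + x2 + x3) (x1 * x2 + x1 * x3 + x2 * x3) (x1 * x2 * x3)).
  by rewrite /f /m4 /=; ring.
(* The explicit factor is half the integral difference of the two sides. *)
rewrite E1 E2 E3 -[RHS]addr0 -(mul0r ((2*t^+4 + 3*t^+3 + 2*t^+2 + t + 2)*y^+4
  + (-t^+5 - t^+4 - t^+3 - t)*y^+2
  + (-t^+7 - t^+6 - t^+5 - t^+4 - t^+3 - t^+2 - 1)*y
  + (12*t^+8 + 35*t^+7 + 45*t^+6 + 50*t^+5 + 57*t^+4 + 49*t^+3 + 28*t^+2
     + 16*t + 12))).
by rewrite -char2 /f /Theta_section /m4 /=; ring.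
Qed.

(** The roots of $X^3+X^2+1$ are the Frobenius conjugates $a, a^2, a^4$, so their elementary
    symmetric functions are 1, 0 and 1. *)
Lemma normal_root (K : closedFieldType) : 2%:R = 0 :> K -> exists a : K,
  [/\ a ^+ 8 = a, a + a ^+ 2 + a ^+ 4 = 1, a ^+ 3 + a ^+ 5 + a ^+ 6 = 0
    & a ^+ 7 = 1].
Proof.
move=> char2.
have /closed_rootP[a] : size ('X^3 + 'X^2 + 1%:P : {poly K}) != 1%N.
  by rewrite -addrA size_polyDl ?size_polyXn // size_polyDl ?size_polyXn
             ?size_polyC ?oner_neq0.
rewrite /root !hornerE => /eqP rt; exists a.
(* Equality modulo the ideal $(2, a^3+a^2+1)$ over the integers; [u] and [v] are the cofactors. *)
have modI (x y u v : K) : x = y + 2%:R * u + (a ^+ 3 + a ^+ 2 + 1) * v -> x = y.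
  by rewrite char2 rt !mul0r !addr0.
have a7 : a ^+ 7 = 1.
  apply: (modI _ _
    (- (a ^+ 6 + a ^+ 5 + 2 * a ^+ 4 + 2 * a ^+ 3 + a ^+ 2 + a + 1))
    (a ^+ 4 + a ^+ 3 + a ^+ 2 + 2 * a + 1)).
  by ring.
split=> //; first by rewrite exprS a7 mulr1.
- by apply: (modI _ _ (a ^+ 2) (a - 1)); ring.
- by apply: (modI _ _ 0 (a ^+ 3)); ring.
Qed.

(** * Derivatives, and degrees after substitution *)

(** From $q'r=-qr'$ and coprimality, $q$ divides $q'$, which has smaller degree. *)
Lemma deriv_eq0_coprimep (F : fieldType) (q r : {poly F}) :
  coprimep q r -> (q * r)^`() = 0 -> q^`() = 0.
Proof.
move=> co /eqP; rewrite derivM addr_eq0 => /eqP qr'.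
have q_dvd : q %| q^`() by rewrite -(Gauss_dvdpl _ co) qr' dvdpNr dvdp_mulr.
have [-> | q0] := eqVneq q 0; first by rewrite deriv0.
apply/eqP/negPn/negP => q'0; have := dvdp_leq q'0 q_dvd.
by rewrite leqNgt lt_size_deriv.
Qed.

(** The partial derivative in $y$ of a polynomial in $t$ with coefficients in $R[y]$. *)
Definition deriv_inner (R : nzRingType) (Q : {poly {poly R}}) :=
  map_poly (@deriv R) Q.

Lemma coef_deriv_inner (R : nzRingType) (Q : {poly {poly R}}) i :
  (deriv_inner Q)`_i = (Q`_i)^`().
Proof. by rewrite coef_map_id0 ?deriv0. Qed.

Lemma horner_deriv_inner (R : comNzRingType) (Q : {poly {poly R}}) (a : R) :
  (deriv_inner Q).[a%:P] = (Q.[a%:P])^`().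
Proof.
rewrite (horner_coef_wide _ (size_poly _ _)) horner_coef raddf_sum /=.
apply: eq_bigr => i _.
by rewrite coef_deriv_inner derivM -polyC_exp derivC mulr0 addr0.
Qed.

(* In [{poly {poly R}}] the outer variable is t and the inner one is y. *)
Definition line_subst (R : nzRingType) (n : nat) (l : nat -> {poly R})
    (i : 'I_n.+1) : {poly {poly R}} :=
  if (i < n)%N then map_poly polyC (l i) else 'X%:P.

Local Notation restr l := (mmap (polyC \o polyC) (line_subst l)).

(** Only monomials containing the last variable survive $\partial/\partial y$. That variable
    contributes nothing to the degree in $t$, so the bound drops by one. *)
Lemma size_deriv_inner_restr (K : idomainType) n (l : nat -> {poly K})
    (q : {mpoly K[n.+1]}) d : (forall i, size (l i) <= 2)%N ->
  (msize q <= d.+1)%N -> (size (deriv_inner (restr l q)) <= d)%N.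
Proof.
move=> sl sq; apply/leq_sizeP => k dk.
rewrite coef_deriv_inner coef_sum raddf_sum /=.
apply: big1_seq => m /andP[_ /msize_mdeg_lt/leq_trans/(_ sq) mq].
rewrite /mmap1 big_ord_recr /= {2}/line_subst ltnn.
under eq_bigr do rewrite /line_subst /= ltn_ord -rmorphXn.
rewrite -rmorph_prod -polyC_exp /= coefCM coefMC coef_map /=.
set A := \prod_(i < n) _.
have sA : (size A <= (\sum_(i < n) m (widen_ord (leqnSn n) i)).+1)%N.
  rewrite /A; elim/big_rec2: _ => [|i s p _ IH]; first by rewrite size_poly1.
  apply: leq_trans (size_polyMleq _ _) _.
  set e := m _; have sE : (size (l i ^+ e) <= e.+1)%N.
    apply: leq_trans (size_poly_exp_leq _ _) _.
    by rewrite ltnS -[leqRHS]mul1n leq_mul2r -subn1 leq_subLR sl orbT.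
  by rewrite -subn1 leq_subLR (leq_trans (leq_add sE IH)) // addSn addnS.
case: (ltnP k (size A)) => kA; last first.
  by rewrite (nth_default _ kA) polyC0 mul0r mulr0 deriv0.
move: mq; rewrite mdegE big_ord_recr /=; case: (m ord_max) => [|e].
  by rewrite expr0 mulr1 -polyCM derivC.
rewrite addnS ltnS => mq.
have := leq_trans kA sA; rewrite ltnS leqNgt (leq_trans _ dk) //.
by rewrite (leq_trans _ mq) // leq_addr.
Qed.

(** * Monomial symmetric polynomials: base change, evaluation, degree *)

Lemma map_monomial_sym (F K : nzRingType) (iota : {rmorphism F -> K}) n la :
  map_mpoly iota (monomial_sym F n la) = monomial_sym K n la.
Proof.
rewrite (raddf_sum (map_mpoly iota : {additive {mpoly F[n]} -> {mpoly K[n]}})).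
by apply: eq_bigr => a _; apply: map_mpolyX.
Qed.

Lemma mmap_monomial_sym (R : nzRingType) (S : comNzRingType)
    (f : {rmorphism R -> S}) n (h : 'I_n -> S) la :
  mmap f h (monomial_sym R n la) =
  \sum_(a <- permutations (la ++ nseq (n - size la) 0%N))
     \prod_(i < n) h i ^+ nth 0%N a i.
Proof.
rewrite (raddf_sum (mmap f h : {additive {mpoly R[n]} -> S})).
apply: eq_bigr => a _; rewrite [LHS]mmapX /mmap1.
by apply: eq_bigr => i _; rewrite mnmE.
Qed.

Lemma msize_monomial_sym (F : nzRingType) n la : (size la <= n)%N ->
  (msize (monomial_sym F n la) <= (sumn la).+1)%N.
Proof.
move=> sla; rewrite /monomial_sym; apply: leq_trans (msize_sum _ _ _) _.
apply/bigmax_leqP_seq => a; rewrite mem_permutations => ap _.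
rewrite msizeX ltnS mdegE.
under eq_bigr do rewrite mnmE.
have sa : size a = n by rewrite (perm_size ap) size_cat size_nseq subnKC.
have -> : sumn la = sumn a.
  by rewrite (perm_sumn ap) sumn_cat sumn_nseq mul0n addn0.
by rewrite sumnE -sa (big_nth 0%N) big_mkord.
Qed.

Lemma msize_map_mpoly (F : fieldType) (K : nzRingType)
    (iota : {rmorphism F -> K}) n (p : {mpoly F[n]}) :
  msize (map_mpoly iota p) = msize p.
Proof.
by rewrite !msizeE; apply: perm_big; apply: msupp_map_mpoly (fmorph_inj iota).
Qed.

(** * Factors of the section at seventh roots of unity *)

Lemma deriv_section_y (R : comNzRingType) (t : R) : 2%:R = 0 :> R ->
  (Theta_section t%:P 'X)^`() = (t ^+ 7 + 1)%:P.
Proof.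
move=> char2; have char2X : 2%:R = 0 :> {poly R} by rewrite -polyC_natr char2.
rewrite /Theta_section -!polyC_exp -[1]/1%:P -polyCD.
rewrite !derivD !deriv_mulC derivX !derivXn derivC.
rewrite addr0 -[RHS]addr0.
rewrite -(mul0r (4 * 'X^7 + 2 * t%:P * 'X^3 + (t ^+ 5)%:P * 'X)) -char2X.
by ring.
Qed.

Lemma deriv_section_t (R : comNzRingType) (y : R) : 2%:R = 0 :> R ->
  (Theta_section 'X y%:P)^`() = 'X^6 * y%:P + 'X^4 * y%:P ^+ 2 + y%:P ^+ 4.
Proof.
move=> char2; have char2X : 2%:R = 0 :> {poly R} by rewrite -polyC_natr char2.
have -> : Theta_section 'X y%:P =
    (y ^+ 8)%:P + (y ^+ 4)%:P * 'X + (y ^+ 2)%:P * 'X^5 + y%:P * 'X^7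
    + y%:P + 'X^2.
  by rewrite /Theta_section !polyC_exp; ring.
rewrite !derivD !deriv_mulC derivX !derivXn !derivC !polyC_exp.
rewrite add0r ?addr0 -[RHS]addr0.
rewrite -(mul0r (2 * 'X^4 * y%:P ^+ 2 + 3 * 'X^6 * y%:P + 'X)) -char2X.
by ring.
Qed.

Lemma factor_deriv (K : closedFieldType) (Q R : {poly {poly K}}) (a : K) :
  2%:R = 0 :> K -> a ^+ 7 = 1 ->
  Q * R = Theta_section 'X 'X%:P -> (Q.[a%:P])^`() = 0.
Proof.
move=> char2 a7 QR.
have Theta_a : Q.[a%:P] * R.[a%:P] = Theta_section a%:P 'X.
  by rewrite -hornerM QR /Theta_section !hornerE.
apply: (@deriv_eq0_coprimep _ _ R.[a%:P]); last first.
  by rewrite Theta_a deriv_section_y // a7 (char2 : 1 + 1 = 0).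
apply: Pdiv.ClosedField.root_coprimep => x /eqP Qx; apply/eqP => Rx.
have P0 : Theta_section a x = 0.
  have := congr1 (fun p => p.[x]) Theta_a.
  by rewrite hornerM Qx mul0r /Theta_section !hornerE.
have char2X : 2%:R = 0 :> {poly K} by rewrite -polyC_natr char2.
have dP0 : a ^+ 6 * x + a ^+ 4 * x ^+ 2 + x ^+ 4 = 0.
  have /(congr1 (fun p => p^`().[a%:P].[x])) := QR.
  rewrite derivM deriv_section_t // !(hornerD, hornerM) Qx Rx mul0r mulr0 addr0.
  by rewrite !(hornerD, hornerM, hornerXn, horner_exp, hornerC, hornerX)
     => /esym.
have a20 : a ^+ 2 = 0.
  (* The identity $p-(\partial p/\partial t)^2=t^2$ modulo $t^7-1$ and 2, with explicit
     cofactors. *)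
  transitivity (Theta_section a x - (a ^+ 6 * x + a ^+ 4 * x ^+ 2 + x ^+ 4) ^+ 2
    + (a ^+ 7 - 1) * (a * x ^+ 4 + a ^+ 5 * x ^+ 2 - x)
    + 2%:R * (a ^+ 4 * x ^+ 6 + a ^+ 6 * x ^+ 5 + a ^+ 10 * x ^+ 3 - x)).
    by rewrite /Theta_section; ring.
  by rewrite P0 dP0 a7 char2 subrr !mul0r expr0n subrr !addr0.
move/eqP: a7; rewrite -(subnKC (isT : 2 <= 7)%N) exprD a20 mul0r.
by rewrite eq_sym oner_eq0.
Qed.

(** In characteristic 2 the derivative of $X^7-1$ is $X^6$, which vanishes only at 0, so the seven
    roots are distinct. *)
Lemma roots_of_unity7 (K : closedFieldType) : 2%:R = 0 :> K ->
  exists s : seq K, [/\ uniq s, size s = 7 & forall a, a \in s -> a ^+ 7 = 1].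
Proof.
move=> char2; have [s] := closed_field_poly_normal ('X^7 - 1 : {poly K}).
rewrite lead_coefXnsubC // scale1r => Es; exists s; split.
- rewrite -separable_prod_XsubC -Es.
  rewrite unlock; apply: Pdiv.ClosedField.root_coprimep => x.
  rewrite derivB derivXn derivC subr0 hornerMn rootE.
  rewrite !(hornerXn, hornerD, hornerN, hornerC) subr_eq0 => /eqP x7.
  rewrite (_ : x ^+ 7.-1 *+ 7 = x ^+ 6); last first.
    by rewrite -[RHS]addr0 -[X in _ + X](mul0r (3%:R * x ^+ 6)) -char2; ring.
  by apply: contra_eqN x7 => /eqP x6; rewrite exprS x6 mulr0 eq_sym oner_eq0.
- have := congr1 (fun p : {poly K} => size p) Es.
  by rewrite size_XnsubC // size_prod_XsubC => -[].
- move=> a; rewrite -root_prod_XsubC -Es rootE !hornerE subr_eq0.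
  by move/eqP.
Qed.

Lemma deriv_restr_factor (K : closedFieldType) n (l : nat -> {poly K})
    (q : {mpoly K[n.+1]}) (R : {poly {poly K}}) :
  2%:R = 0 :> K -> (forall i, size (l i) <= 2)%N -> (msize q <= 8)%N ->
  restr l q * R = Theta_section 'X 'X%:P -> ((restr l q).[0])^`() = 0.
Proof.
move=> char2 sl sq qR; rewrite -polyC0 -horner_deriv_inner.
suff -> : deriv_inner (restr l q) = 0 by rewrite horner0.
have [s [us ss s7]] := roots_of_unity7 char2.
apply/eqP/negPn/negP => nz.
have := @max_poly_roots _ _ (map polyC s) nz.
rewrite size_map ss map_inj_uniq; last exact: polyC_inj.
rewrite ltnNge size_deriv_inner_restr // => H; apply/notF/H => //.
apply/allP => _ /mapP[a /s7 a7 ->]; rewrite rootE horner_deriv_inner.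
by rewrite (factor_deriv char2 a7 qR).
Qed.

(** * Restriction of $\Theta_4$ and conclusion *)

Lemma unit_msize_le1 (K : fieldType) n (p : {mpoly K[n]}) :
  p != 0 -> (p \is a GRing.unit) = (msize p <= 1)%N.
Proof.
move=> p0; apply/idP/idP => [/andP[/eqP-> _]|/msize1_polyC pC].
  by rewrite msizeC; case: (_ != 0).
rewrite pC; apply: rmorph_unit; rewrite unitfE.
by apply: contraNneq p0 => p00; rewrite pC p00 mpolyC0.
Qed.

Lemma restr_Theta4 (K : closedFieldType) (iota : {rmorphism 'F_2 -> K}) :
  2%:R = 0 :> K -> exists2 l : nat -> {poly K}, forall i, (size (l i) <= 2)%N &
  restr l (map_mpoly iota Theta4) = Theta_section 'X 'X%:P.
Proof.
move=> char2.
have [a [a8 E1 E2 E3]] := normal_root char2.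
(* As $a^8=a$, squaring the coefficients permutes these forms cyclically, so their symmetric
   functions have coefficients in $\mathbb F_2$. *)
pose l : nat -> {poly K} := nth 0 [:: a%:P * 'X + (a ^+ 2)%:P;
  (a ^+ 2)%:P * 'X + (a ^+ 4)%:P; (a ^+ 4)%:P * 'X + a%:P].
exists l => [i|].
  have s2 (b c : K) : (size (b%:P * 'X + c%:P)%R <= 2)%N.
    by rewrite size_MXaddC; case: ifP => //; rewrite ltnS size_polyC_leq1.
  by case: i => [|[|[|[|i]]]]; rewrite /l /= ?s2 ?size_poly0.
have char2X : 2%:R = 0 :> {poly {poly K}} by rewrite -!polyC_natr char2.
pose A : {poly {poly K}} := a%:P%:P.
have CE k : (a ^+ k)%:P%:P = A ^+ k by rewrite !polyC_exp.
have A8 : A ^+ 8 = A by rewrite -CE a8.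
have A1 : A + A ^+ 2 + A ^+ 4 = 1 by rewrite -!CE -!polyCD E1.
have A2 : A ^+ 3 + A ^+ 5 + A ^+ 6 = 0 by rewrite -!CE -!polyCD E2.
have A3 : A ^+ 7 = 1 by rewrite -!CE E3.
pose T : {poly {poly K}} := 'X.
have S1 : (A * T + A ^+ 2) + (A ^+ 2 * T + A ^+ 4) + (A ^+ 4 * T + A) = T + 1.
  by rewrite -A1 -[X in _ = X + _]mul1r -[X in _ = X * _ + _]A1; ring.
have S2 : (A * T + A ^+ 2) * (A ^+ 2 * T + A ^+ 4)
  + (A * T + A ^+ 2) * (A ^+ 4 * T + A)
  + (A ^+ 2 * T + A ^+ 4) * (A ^+ 4 * T + A) = T.
  transitivity ((A ^+ 3 + A ^+ 5 + A ^+ 6) * (T ^+ 2 + T + 1)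
    + (A + A ^+ 2 + A ^+ 4) * T + (A ^+ 8 - A) * T); first by ring.
  by rewrite A1 A2 A8 subrr !mul0r mul1r add0r addr0.
have S3 : (A * T + A ^+ 2) * (A ^+ 2 * T + A ^+ 4) * (A ^+ 4 * T + A)
    = T ^+ 3 + T ^+ 2 + 1.
  transitivity (A ^+ 7 * (T ^+ 3 + 1) + (A + A ^+ 2 + A ^+ 4) * T ^+ 2
    + (A ^+ 3 + A ^+ 5 + A ^+ 6) * T
    + (A ^+ 8 - A) * (T ^+ 2 * (A + 1) + T * A ^+ 2)); first by ring.
  by rewrite A1 A2 A3 A8; ring.
rewrite -(sum_Theta4_monomials _ char2X S1 S2 S3).
pose f : {rmorphism {mpoly 'F_2[4]} -> {mpoly K[4]}} := map_mpoly iota.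
pose g : {rmorphism {mpoly K[4]} -> {poly {poly K}}} := restr l.
rewrite -[LHS]/(g (f Theta4)) /Theta4 !(rmorphD f) !(rmorphD g) {}/f {}/g.
rewrite /= !map_monomial_sym !mmap_monomial_sym.
(* Enumerating the rearrangements turns the five sums into explicit polynomials. *)
do 5 (set s := permutations _; vm_compute in s; rewrite {}/s).
rewrite !big_cons !big_nil !big_ord_recl !big_ord0 /line_subst /l /=.
have lE b c : map_poly polyC (b%:P * 'X + c%:P) = b%:P%:P * 'X + c%:P%:P
    :> {poly {poly K}}.
  by rewrite rmorphD rmorphM /= map_polyX !map_polyC.
rewrite !lE !CE -/A -/T {lE CE S1 S2 S3}.
move: (A * T + _) (A ^+ 2 * T + _) (A ^+ 4 * T + _) 'X%:P => x1 x2 x3 y.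
by ring.
Qed.

Theorem theoremA1 (K : closedFieldType) (iota : {rmorphism 'F_2 -> K})
    (closureK : is_algebraic_closure iota) :
  irreducible_elt (map_mpoly iota Theta4).
Proof.
have char2 : 2%:R = 0 :> K.
  by rewrite -(rmorph_nat iota) (_ : 2%:R = 0) ?rmorph0 //; apply/val_inj.
have [l sl image] := restr_Theta4 iota char2.
have sTheta : (msize (map_mpoly iota Theta4) <= 9)%N.
  rewrite msize_map_mpoly.
  by do ![apply: leq_trans (msizeD_le _ _) _; rewrite geq_max;
          apply/andP; split]; apply: msize_monomial_sym.
(* At $t=0$ one has $\partial p/\partial y=0^7+1=1$. This value shows that $\Theta_4$ is nonzero and
   not constant, and later refutes a factorization. *)
have Theta_deriv : ((restr l (map_mpoly iota Theta4)).[0])^`() = 1.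
  have -> : (restr l (map_mpoly iota Theta4)).[0] = Theta_section 0%:P 'X.
    by rewrite image /Theta_section !hornerE.
  by rewrite deriv_section_y // expr0n add0r.
have Theta0 : map_mpoly iota Theta4 != 0.
  apply/eqP => E; move: Theta_deriv; rewrite E mmap0 horner0 deriv0.
  by move/eqP; rewrite eq_sym oner_eq0.
split=> //.
  rewrite unit_msize_le1 //; apply/negP => /msize1_polyC E.
  move: Theta_deriv; rewrite E mmapC /= hornerC derivC.
  by move/eqP; rewrite eq_sym oner_eq0.
move=> q r qr; move: Theta0; rewrite qr mulf_eq0 negb_or => /andP[q0 r0].
rewrite !unit_msize_le1 //.
case: (leqP (msize q) 1) => [|q1]; first by left.
case: (leqP (msize r) 1) => [|r1]; first by right.
move: sTheta; rewrite qr msizeM // => sqr.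
(* [msize] is the total degree plus one: the degrees of [q] and [r] add up to at most 8 and each is
   at least 1. *)
have sq : (msize q <= 8)%N.
  case: (msize r) r1 sqr => [|[|e]] //= _; rewrite !addnS /= ltnS.
  by apply: leq_trans; rewrite leq_addr.
have sr : (msize r <= 8)%N.
  case: (msize q) q1 sqr => [|[|e]] //= _; rewrite !addSn /= ltnS.
  by apply: leq_trans; rewrite leq_addl.
have QR : restr l q * restr l r = Theta_section 'X 'X%:P
  by rewrite -image qr rmorphM.
have RQ : restr l r * restr l q = Theta_section 'X 'X%:P by rewrite mulrC.
move: Theta_deriv; rewrite image -QR hornerM derivM.
rewrite (deriv_restr_factor char2 sl sq QR) (deriv_restr_factor char2 sl sr RQ).
by rewrite mul0r mulr0 addr0 => /eqP; rewrite eq_sym oner_eq0.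
Qed.
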